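(* Let $\mathbb F$ be a field of characteristic $0$. Let $\{\lambda^n/\mu^n\}_{n\ge0}$ be a graded skew partition sequence and for each $n\geq0$ put $u_n=e_{\lambda^n/\mu^n}$. Then the set $\{u_n\}_{n\geq0}$ is algebraically independent over $\mathbb F$ and generates $\Lambda_{\mathbb F}$ as an $\mathbb F$-algebra if and only if, for each $n\geq 1$, $\lambda_1^n\geq n$.
   Context: $\Lambda_{\mathbb F}$ is the ring of symmetric functions in infinitely many variables over $\mathbb F$, $e_\lambda=\prod_i e_{\lambda_i}$ are elementary symmetric functions, and the Hall inner product satisfies $\langle h_\lambda,m_\mu\rangle=\delta_{\lambda\mu}$. A skew partition of $n$ is any pair $(\lambda,\mu)$ of partitions with $|\lambda|-|\mu|=n$, written $\lambda/\mu$ (containment not assumed); a graded skew partition sequence has $\lambda^n/\mu^n$ a skew partition of $n$ for each $n$. The skew elementary function is defined by $\langle e_{\lambda/\mu},f\rangle=\langle e_\lambda,e_\mu f\rangle$ for all $f\in\Lambda_{\mathbb F}$. $\lambda_1^n$ is the largest part of $\lambda^n$.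
   Formalization: Algebraic independence is stated for u_n with n ≥ 1 only: u_0 has degree 0, so it is a scalar, and a set containing it is never algebraically independent (e.g. u_0 = 1 when λ^n = (n), μ^n = ∅). Generation is stated for all n ≥ 0. *)

(* Defs.v *)
From HB Require Import structures.
From mathcomp Require Import all_boot all_order all_fingroup all_algebra.
From mathcomp Require Import boolp classical_sets.
From mathcomp Require Import freeg mpoly.

Set Implicit Arguments.
Unset Strict Implicit.
Unset Printing Implicit Defensive.

Import GRing.Theory.
Local Open Scope ring_scope.

(* Integer partitions: weakly decreasing lists of positive integers. *)

Record intpart := IntPart {
  parts :> seq nat;
  intpart_sorted : sorted geq parts;
  intpart_pos : 0%N \notin parts }.

(* The size |lambda| is [sumn lam]; the largest part of the empty partition
   is 0. *)
Definition largest_part (lam : intpart) : nat := head 0%N lam.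

(* The addition (rather than a truncated subtraction) makes
   |lambda| - |mu| = n an identity between integers. *)
Definition skew_partition (n : nat) (lam mu : intpart) : Prop :=
  sumn lam = (n + sumn mu)%N.

Definition graded_skew_partition_sequence (lam mu : nat -> intpart) : Prop :=
  forall n, skew_partition n (lam n) (mu n).

(* The restriction F[x_0..x_n] -> F[x_0..x_(n-1)] setting the last variable
   to zero. *)
Definition mrestr (F : fieldType) (n : nat) (p : {mpoly F[n.+1]}) :
    {mpoly F[n]} :=
  p \mPo [tuple oapp (fun j : 'I_n => 'X_j) 0 (unlift ord_max i) | i < n.+1].

(* Lambda_F, as the inverse limit, in the category of graded rings, of the
   rings of symmetric polynomials in n variables: compatible sequences of
   symmetric polynomials of bounded degree. *)
Record symfun (F : fieldType) := SymFun {
  sfproj :> forall n, {mpoly F[n]};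
  sfproj_sym : forall n, sfproj n \is symmetric;
  sfproj_restr : forall n, mrestr (sfproj n.+1) = sfproj n;
  sfproj_bounded : exists d, forall n, (msize (sfproj n) <= d)%N }.

Section SymFunAlgebra.
Context (F : fieldType).
Implicit Types f g h : symfun F.

Lemma symfunP f g : (forall n, f n = g n) -> f = g.
Proof.
case: f g => [f f1 f2 f3] [g g1 g2 g3] /= fg.
have E : f = g by exact: functional_extensionality_dep fg.
by subst g; congr SymFun; exact: Prop_irrelevance.
Qed.

HB.instance Definition _ := gen_eqMixin (symfun F).
HB.instance Definition _ := gen_choiceMixin (symfun F).

Fact sf_const_subproof (c : F) : exists d, forall n,
  (msize (c%:MP : {mpoly F[n]}) <= d)%N.
Proof. by exists 1%N => n; rewrite mmeasureC; case: (c != 0). Qed.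

Definition sf_const (c : F) : symfun F.
Proof.
refine (@SymFun F (fun n => c%:MP) _ _ (sf_const_subproof c)).
- by move=> n; rewrite -alg_mpolyC rpredZ // rpred1.
- by move=> n; rewrite /mrestr comp_mpolyC.
Defined.

Definition sf_opp f : symfun F.
Proof.
refine (@SymFun F (fun n => - f n) _ _ _).
- by move=> n; rewrite rpredN sfproj_sym.
- by move=> n; rewrite /mrestr raddfN /= -/(mrestr _) sfproj_restr.
- by have [d df] := sfproj_bounded f; exists d => n; rewrite mmeasureN.
Defined.

Definition sf_add f g : symfun F.
Proof.
refine (@SymFun F (fun n => f n + g n) _ _ _).
- by move=> n; rewrite rpredD // sfproj_sym.
- by move=> n; rewrite /mrestr raddfD /= -!/(mrestr _) !sfproj_restr.
- have [d df] := sfproj_bounded f; have [e eg] := sfproj_bounded g.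
  exists (maxn d e) => n; apply: leq_trans (mmeasureD_le _ _ _) _.
  by rewrite geq_max !leq_max df eg orbT.
Defined.

Definition sf_mul f g : symfun F.
Proof.
refine (@SymFun F (fun n => f n * g n) _ _ _).
- by move=> n; rewrite rpredM // sfproj_sym.
- by move=> n; rewrite /mrestr rmorphM /= -!/(mrestr _) !sfproj_restr.
- have [d df] := sfproj_bounded f; have [e eg] := sfproj_bounded g.
  exists (d + e)%N => n.
  have [->|f0] := eqVneq (f n) 0; first by rewrite mul0r mmeasure0.
  have [->|g0] := eqVneq (g n) 0; first by rewrite mulr0 mmeasure0.
  rewrite msizeM //; apply: leq_trans (leq_pred _) _.
  exact: leq_add (df n) (eg n).
Defined.

Definition sf_scale (c : F) f : symfun F.
Proof.
refine (@SymFun F (fun n => c *: f n) _ _ _).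
- by move=> n; rewrite rpredZ // sfproj_sym.
- by move=> n; rewrite /mrestr linearZ /= -/(mrestr _) sfproj_restr.
- have [d df] := sfproj_bounded f; exists d => n.
  exact: leq_trans (msizeZ_le _ _) (df n).
Defined.

Fact sf_addA : associative sf_add.
Proof. by move=> f g h; apply: symfunP => n; exact: addrA. Qed.
Fact sf_addC : commutative sf_add.
Proof. by move=> f g; apply: symfunP => n; exact: addrC. Qed.
Fact sf_add0 : left_id (sf_const 0) sf_add.
Proof. by move=> f; apply: symfunP => n; rewrite /= mpolyC0 add0r. Qed.
Fact sf_addN : left_inverse (sf_const 0) sf_opp sf_add.
Proof. by move=> f; apply: symfunP => n; rewrite /= mpolyC0 addNr. Qed.

HB.instance Definition _ :=
  GRing.isZmodule.Build (symfun F) sf_addA sf_addC sf_add0 sf_addN.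

Fact sf_mulA : associative sf_mul.
Proof. by move=> f g h; apply: symfunP => n; exact: mulrA. Qed.
Fact sf_mulC : commutative sf_mul.
Proof. by move=> f g; apply: symfunP => n; exact: mulrC. Qed.
Fact sf_mul1 : left_id (sf_const 1) sf_mul.
Proof. by move=> f; apply: symfunP => n; rewrite /= mpolyC1 mul1r. Qed.
Fact sf_mulDl : left_distributive sf_mul sf_add.
Proof. by move=> f g h; apply: symfunP => n; exact: mulrDl. Qed.
Fact sf_1_neq0 : sf_const 1 != 0.
Proof.
apply/eqP => /(congr1 (fun f : symfun F => f 0%N)) /eqP /=.
by rewrite mpolyC0 mpolyC1 oner_eq0.
Qed.

HB.instance Definition _ := GRing.Zmodule_isComNzRing.Build (symfun F)
  sf_mulA sf_mulC sf_mul1 sf_mulDl sf_1_neq0.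

Fact sf_scaleA c d f : sf_scale c (sf_scale d f) = sf_scale (c * d) f.
Proof. by apply: symfunP => n; exact: scalerA. Qed.
Fact sf_scale1 : left_id 1 sf_scale.
Proof. by move=> f; apply: symfunP => n; exact: scale1r. Qed.
Fact sf_scaleDr : right_distributive sf_scale +%R.
Proof. by move=> c f g; apply: symfunP => n; exact: scalerDr. Qed.
Fact sf_scaleDl f : {morph sf_scale^~ f : c d / c + d}.
Proof. by move=> c d; apply: symfunP => n; exact: scalerDl. Qed.

HB.instance Definition _ := GRing.Zmodule_isLmodule.Build F (symfun F)
  sf_scaleA sf_scale1 sf_scaleDr sf_scaleDl.

Fact sf_scaleAl (c : F) f g : c *: (f * g) = (c *: f) * g.
Proof. by apply: symfunP => n; exact: scalerAl. Qed.

HB.instance Definition _ :=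
  GRing.Lmodule_isLalgebra.Build F (symfun F) sf_scaleAl.
HB.instance Definition _ := GRing.Lalgebra_isComAlgebra.Build F (symfun F).

End SymFunAlgebra.

Section MonomialSums.
Context (F : fieldType).

Definition mnm_ext n (m : 'X_{1..n}) : 'X_{1..n.+1} :=
  [multinom oapp m 0%N (unlift ord_max i) | i < n.+1].

Lemma mcoeff_mrestr n (p : {mpoly F[n.+1]}) (m : 'X_{1..n}) :
  (mrestr p)@_m = p@_(mnm_ext m).
Proof.
rewrite /mrestr comp_mpolyEX raddf_sum /= [in RHS](mpolyE p) raddf_sum /=.
apply: eq_bigr => k _; rewrite !mcoeffZ mcoeffX comp_mpolyX; congr (_ * _).
rewrite big_ord_recr /= tnth_mktuple unlift_none /=.
have -> : \prod_(i < n) tnth [tuple oapp (fun j : 'I_n => 'X_j) 0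
      (unlift ord_max i) | i < n.+1] (widen_ord (leqnSn n) i)
        ^+ k (widen_ord (leqnSn n) i) =
    'X_[[multinom k (fintype.lift ord_max i) | i < n]] :> {mpoly F[n]}.
  rewrite mpolyXE_id; apply: eq_bigr => i _.
  have -> : widen_ord (leqnSn n) i = fintype.lift ord_max i.
    by apply: val_inj; rewrite /= /bump leqNgt ltn_ord.
  by rewrite tnth_mktuple liftK mnmE.
have [k0|k0] := eqVneq (k ord_max) 0%N; last first.
  rewrite expr0n (negPf k0) mulr0 mcoeff0; case: eqP => // E.
  by move: k0; rewrite E mnmE unlift_none eqxx.
rewrite k0 expr0 mulr1 mcoeffX; congr (nat_of_bool _)%:R.
apply/eqP/eqP => [<-|->]; apply/mnmP => i; rewrite !mnmE.
  by case: unliftP => [j ->|->] /=; rewrite ?mnmE.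
by rewrite liftK.
Qed.

Definition mnm_sum d (P : forall n, pred 'X_{1..n}) n : {mpoly F[n]} :=
  \sum_(m : 'X_{1..n < d.+1} | P n m) 'X_[m].

Lemma mcoeff_mnm_sum d (P : forall n, pred 'X_{1..n}) n (m : 'X_{1..n}) :
  (forall n m, P n m -> (mdeg m <= d)%N) -> (mnm_sum d P n)@_m = (P n m)%:R.
Proof.
move=> Pd; rewrite /mnm_sum raddf_sum /=.
have [Pm|nPm] := boolP (P n m); last first.
  rewrite big1 // => k Pk; rewrite mcoeffX; case: eqP => // E.
  by rewrite -E Pk in nPm.
have md : (mdeg m < d.+1)%N by rewrite ltnS (Pd _ _ Pm).
rewrite (bigD1 (BMultinom md)) //= mcoeffX eqxx big1 ?addr0 // => k.
case/andP=> _ km; rewrite mcoeffX; case: eqP => // E.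
by case/eqP: km; apply: val_inj.
Qed.

Lemma msize_mnm_sum d (P : forall n, pred 'X_{1..n}) n :
  (msize (mnm_sum d P n) <= d.+1)%N.
Proof.
apply: leq_trans (mmeasure_sum _ _ _ _) _; apply/bigmax_leqP => m _.
by rewrite mmeasureX bmdeg.
Qed.

Lemma mnm_sum_sym d (P : forall n, pred 'X_{1..n}) n :
  (forall n m, P n m -> (mdeg m <= d)%N) ->
  (forall n (m : 'X_{1..n}) (s : 'S_n),
     P n [multinom m (s i) | i < n] = P n m) ->
  mnm_sum d P n \is symmetric.
Proof.
move=> Pd Ps; apply/issymP => s; apply/mpolyP => m.
by rewrite mcoeff_sym !mcoeff_mnm_sum // Ps.
Qed.

Lemma mnm_sum_restr d (P : forall n, pred 'X_{1..n}) n :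
  (forall n m, P n m -> (mdeg m <= d)%N) ->
  (forall n (m : 'X_{1..n}), P n.+1 (mnm_ext m) = P n m) ->
  mrestr (mnm_sum d P n.+1) = mnm_sum d P n.
Proof.
by move=> Pd Pe; apply/mpolyP => m; rewrite mcoeff_mrestr !mcoeff_mnm_sum // Pe.
Qed.

(* The nonzero exponents of a monomial; up to order, its shape. *)
Definition mnm_shape n (m : 'X_{1..n}) : seq nat := [seq i <- m | i != 0%N].

Lemma mnm_shape_perm n (m : 'X_{1..n}) (s : 'S_n) :
  perm_eq (mnm_shape [multinom m (s i) | i < n]) (mnm_shape m).
Proof.
apply: perm_filter; rewrite perm_sym.
by rewrite perm_sym; apply/tuple_permP; exists s.
Qed.

Lemma mnm_shape_ext n (m : 'X_{1..n}) :
  perm_eq (mnm_shape (mnm_ext m)) (mnm_shape m).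
Proof.
rewrite /mnm_shape /mnm_ext /=.
rewrite enum_ordSr map_rcons filter_rcons /= unlift_none /= -map_comp.
rewrite -[X in perm_eq _ (filter _ X)]map_tnth_enum.
apply/seq.permP => a; congr (count _ (filter _ _)).
apply: eq_map => i /=.
have -> : widen_ord (leqnSn n) i = fintype.lift ord_max i.
  by apply: val_inj; rewrite /= /bump leqNgt ltn_ord.
by rewrite liftK.
Qed.

Lemma mdeg_shape n (m : 'X_{1..n}) : mdeg m = sumn (mnm_shape m).
Proof.
rewrite sumnE /mnm_shape big_filter mdegE -(big_tuple _ _ m predT id) /=.
by rewrite [RHS]big_mkcond /=; apply: eq_bigr => -[].
Qed.

End MonomialSums.

Section Bases.
Context (F : fieldType).

Definition complete_pred k n : pred 'X_{1..n} := fun m => mdeg m == k.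

Fact complete_predP k n (m : 'X_{1..n}) :
  complete_pred k m -> (mdeg m <= k)%N.
Proof. by move=> /eqP ->. Qed.

Fact complete_pred_perm k n (m : 'X_{1..n}) (s : 'S_n) :
  complete_pred k [multinom m (s i) | i < n] = complete_pred k m.
Proof. by rewrite /complete_pred mdeg_mperm. Qed.

Fact complete_pred_ext k n (m : 'X_{1..n}) :
  complete_pred k (mnm_ext m) = complete_pred k m.
Proof.
by rewrite /complete_pred !mdeg_shape (perm_sumn (mnm_shape_ext m)).
Qed.

(* The sum of all monomials of degree k. *)
Definition complete_sf (k : nat) : symfun F :=
  @SymFun F (mnm_sum F k (complete_pred k))
    (fun n => mnm_sum_sym F n (@complete_predP k) (@complete_pred_perm k))
    (fun n => mnm_sum_restr F n (@complete_predP k) (@complete_pred_ext k))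
    (ex_intro _ k.+1 (msize_mnm_sum F k (complete_pred k))).

Definition monomial_pred (lam : intpart) n : pred 'X_{1..n} :=
  fun m => perm_eq (mnm_shape m) lam.

Fact monomial_predP lam n (m : 'X_{1..n}) :
  monomial_pred lam m -> (mdeg m <= sumn lam)%N.
Proof. by move=> mlam; rewrite mdeg_shape (perm_sumn mlam). Qed.

Fact monomial_pred_perm lam n (m : 'X_{1..n}) (s : 'S_n) :
  monomial_pred lam [multinom m (s i) | i < n] = monomial_pred lam m.
Proof. by rewrite /monomial_pred (permPl (mnm_shape_perm m s)). Qed.

Fact monomial_pred_ext lam n (m : 'X_{1..n}) :
  monomial_pred lam (mnm_ext m) = monomial_pred lam m.
Proof. by rewrite /monomial_pred (permPl (mnm_shape_ext m)). Qed.

(* The sum of all distinct monomials whose nonzero exponents are,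
   up to order, the parts of lambda. *)
Definition sf_m (lam : intpart) : symfun F :=
  @SymFun F (mnm_sum F (sumn lam) (monomial_pred lam))
    (fun n => mnm_sum_sym F n (@monomial_predP lam)
       (@monomial_pred_perm lam))
    (fun n => mnm_sum_restr F n (@monomial_predP lam) (@monomial_pred_ext lam))
    (ex_intro _ (sumn lam).+1
       (msize_mnm_sum F (sumn lam) (monomial_pred lam))).

Fact mesym_restr k n : mrestr (mesym n.+1 F k) = mesym n F k.
Proof.
apply/mpolyP => m; rewrite mcoeff_mrestr !mcoeff_mesym /mechar.
congr (nat_of_bool (_ && _))%:R.
  by rewrite !mdeg_shape (perm_sumn (mnm_shape_ext m)).
apply/forallP/forallP => m1 i.
  by have := m1 (fintype.lift ord_max i); rewrite mnmE liftK.
by rewrite mnmE; case: unliftP => [j _|_] //=; exact: m1.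
Qed.

Fact mesym_bounded k : exists d, forall n, (msize (mesym n F k) <= d)%N.
Proof.
exists k.+1 => n; rewrite mesymE.
apply: leq_trans (mmeasure_sum _ _ _ _) _; apply/bigmax_leqP => h /eqP hk.
by rewrite msizeX mdeg_mesym1 hk.
Qed.

Definition elementary_sf (k : nat) : symfun F :=
  @SymFun F (fun n => mesym n F k) (fun n => mesym_sym n F k)
    (mesym_restr k) (mesym_bounded k).

Definition sf_h (lam : intpart) : symfun F := \prod_(k <- lam) complete_sf k.
Definition sf_e (lam : intpart) : symfun F := \prod_(k <- lam) elementary_sf k.

(* The h_lambda and the m_mu form two bases of Lambda_F, so exactly one form
   satisfies this predicate. *)
Definition is_hall (B : symfun F -> symfun F -> F) : Prop :=
  [/\ forall g, scalar (B^~ g),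
      forall f, scalar (B f) &
      forall lam mu : intpart,
        B (sf_h lam) (sf_m mu) = (parts lam == parts mu)%:R].

Definition hall : symfun F -> symfun F -> F :=
  xget (fun _ _ => 0) [set B | is_hall B].

(* The Hall form is nondegenerate and graded with finite-dimensional
   components, so exactly one u satisfies the defining property. *)
Definition skew_e (lam mu : intpart) : symfun F :=
  xget 0 [set u | forall f, hall u f = hall (sf_e lam) (sf_e mu * f)].

End Bases.

Section GeneratingFamilies.
Context (F : fieldType) (A : comAlgType F).

Definition alg_independent (v : nat -> A) : Prop :=
  forall n (p : {mpoly F[n]}), mmap (in_alg A) (fun i : 'I_n => v i) p = 0 ->
    p = 0.

Definition alg_generates (v : nat -> A) : Prop :=
  forall a : A, exists n (p : {mpoly F[n]}),
    a = mmap (in_alg A) (fun i : 'I_n => v i) p.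

End GeneratingFamilies.

(* Main.v *)
(* Let omega be the algebra endomorphism of Lambda_F with e_k |-> h_k. Since
   <h_lambda, f> is the coefficient of x^lambda in f, and since the coefficients
   of x^lambda in h_mu and in e_mu count matrices with prescribed row and column
   sums, hence are symmetric in lambda and mu, one gets
   <e_lambda, f> = [x^lambda] omega(f), and so
     <e_lambda, e_mu f> = [x^lambda] (h_mu omega(f))
                        = sum_alpha [x^alpha] h_mu * <e_(lambda - alpha), f>,
   that is, e_(lambda/mu) = sum_alpha ([x^alpha] h_mu) e_(lambda - alpha), where
   alpha ranges over the exponents below lambda. Here [x^alpha] h_mu is a natural
   number, positive exactly when |alpha| = |mu|. Hence e_n occurs in the
   expansion of u_n iff some part of lambda^n is at least n, and then u_n is a
   nonzero multiple of e_n plus a polynomial in e_1, ..., e_(n-1), so that the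
   substitution e |-> u is triangular and invertible. Otherwise, the
   specialization e_n |-> 'X, e_k |-> 0 (k <> n) maps every u_i, hence everything
   they generate, to a polynomial with no term of degree 1, while e_n |-> 'X. *)

From HB Require Import structures.
Require Import Defs.
From mathcomp Require Import all_boot all_algebra.
From mathcomp Require Import all_fingroup boolp classical_sets ssrcomplements mpoly.

Set Implicit Arguments.
Unset Strict Implicit.
Unset Printing Implicit Defensive.

Import GRing.Theory.
Local Open Scope ring_scope.

(** * Coefficients indexed by exponent sequences *)

Section Coefficients.
Context (F : fieldType).
Implicit Types (f g : symfun F) (s t : seq nat).

(** The length of [s] fixes the number of variables, so coefficients taken in different numbers of
    variables can be compared without casts. *)
Definition sf_coef f s : F :=
  (f (size s))@_[multinom of in_tuple s].

Lemma sf_coefE f n (m : 'X_{1..n}) : sf_coef f m = (f n)@_m.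
Proof.
case: m => [[s Hs]]; rewrite /sf_coef /=.
move: (Hs); move/eqP: Hs => Hs; move: Hs (f) => <- g Hs.
by congr (_@_ _); apply: val_inj; apply: val_inj.
Qed.

Lemma sf_coefP f g : (forall s, sf_coef f s = sf_coef g s) -> f = g.
Proof.
by move=> fg; apply: symfunP => n; apply/mpolyP => m; rewrite -!sf_coefE.
Qed.

Lemma sf_coefD f g s : sf_coef (f + g) s = sf_coef f s + sf_coef g s.
Proof. exact: mcoeffD. Qed.

Lemma sf_coefZ c f s : sf_coef (c *: f) s = c * sf_coef f s.
Proof. exact: mcoeffZ. Qed.

Lemma sf_coef_perm f s t : perm_eq s t -> sf_coef f s = sf_coef f t.
Proof.
move=> st; have e := perm_size st.
have := st; rewrite -[s]/(val (in_tuple s)) => st'.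
have e' : size t == size s by rewrite e.
have : perm_eq (in_tuple s) (Tuple e') by [].
case/tuple_permP => p E.
have -> : sf_coef f t = (f (size s))@_[multinom of Tuple e'].
  by rewrite -sf_coefE.
have /issymP/(_ p) <- := sfproj_sym f (size s).
rewrite mcoeff_sym /sf_coef; congr (_@_ _).
apply/mnmP => i; rewrite mnmE !multinomE /=.
have E' : in_tuple s = [tuple tnth (Tuple e') (p j) | j < size s].
  exact: val_inj.
by have /= := congr1 (fun u => tnth u i) E'; rewrite tnth_mktuple.
Qed.

Lemma sf_coef_rcons0 f s : sf_coef f (rcons s 0%N) = sf_coef f s.
Proof.
pose m := [multinom of in_tuple s].
have -> : sf_coef f (rcons s 0%N) = _ := sf_coefE f (mnmwiden m).
rewrite /sf_coef -[in RHS]sfproj_restr mcoeff_mrestr.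
congr (_@_ _); apply/mnmP => i; rewrite mnmE.
case: unliftP => [j ->|->] /=; last by rewrite mnmwiden_ordmax.
rewrite -[RHS]mnmwiden_widen; congr (fun_of_multinom _ _).
by apply: val_inj; rewrite /= /bump leqNgt ltn_ord.
Qed.

Lemma sf_coef_cat0 f s k : sf_coef f (s ++ nseq k 0%N) = sf_coef f s.
Proof.
elim: k s => [|k IH] s; first by rewrite cats0.
by rewrite -cat_rcons IH sf_coef_rcons0.
Qed.

Lemma perm_filter0 s :
  perm_eq ([seq i <- s | i != 0%N] ++ nseq (count_mem 0%N s) 0%N) s.
Proof.
elim: s => //= -[|a] s IH /=; last by rewrite perm_cons.
by rewrite -cat1s perm_catCA /= perm_cons.
Qed.

(** Symmetry moves the zero exponents to the end, where compatibility with restriction drops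
    them. *)
Lemma sf_coef_filter0 f s : sf_coef f [seq i <- s | i != 0%N] = sf_coef f s.
Proof. by rewrite -(sf_coef_perm f (perm_filter0 s)) sf_coef_cat0. Qed.

Lemma sumn_filter0 s : sumn [seq i <- s | i != 0%N] = sumn s.
Proof. by elim: s => //= -[|a] s //= ->. Qed.

Lemma size_le_sumn s : 0%N \notin s -> (size s <= sumn s)%N.
Proof.
elim: s => //= -[|a] s IH; rewrite inE //= => /IH; rewrite addSn ltnS => h.
exact: leq_trans h (leq_addl _ _).
Qed.

Lemma sf_bounded_eq0 f d :
  (forall n, (msize (f n) <= d.+1)%N) -> f d = 0 -> f = 0.
Proof.
move=> fd f0; apply: sf_coefP => s; rewrite [RHS]mcoeff0 -sf_coef_filter0.
(* A monomial of degree at most d involves at most d variables. *)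
set s' := [seq _ <- _ | _].
have s'0 : 0%N \notin s' by rewrite mem_filter eqxx.
have [sd|sd] := leqP (size s') d; last first.
  apply/memN_msupp_eq0/msize_mdeg_ge/(leq_trans (fd _))/(leq_trans sd).
  by rewrite /mdeg /= -[X in (_ <= X)%N]sumnE size_le_sumn.
rewrite -(sf_coef_cat0 _ _ (d - size s')).
have e : size (s' ++ nseq (d - size s') 0%N) == d.
  by rewrite size_cat size_nseq subnKC.
by have := sf_coefE f [multinom of Tuple e]; rewrite f0 mcoeff0.
Qed.

End Coefficients.

(** * Spanning by monomial symmetric functions *)

Section MonomialSpan.
Context (F : fieldType).
Implicit Types (f g : symfun F) (s : seq nat).

Fact sorted_shape_sorted s : sorted geq (sort geq [seq i <- s | i != 0%N]).
Proof. by apply: sort_sorted => a b; exact: leq_total. Qed.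

Fact sorted_shape_pos s : 0%N \notin sort geq [seq i <- s | i != 0%N].
Proof. by rewrite mem_sort mem_filter eqxx. Qed.

Definition intpart_of s : intpart :=
  IntPart (sorted_shape_sorted s) (sorted_shape_pos s).

Lemma perm_intpart_of s : perm_eq (intpart_of s) [seq i <- s | i != 0%N].
Proof. by rewrite perm_sort. Qed.

Lemma intpart_perm_eq (lam mu : intpart) :
  perm_eq lam mu = (parts lam == parts mu).
Proof.
apply/idP/eqP => [|-> //]; apply: sorted_eq (intpart_sorted _) (intpart_sorted _).
  by move=> a b c /= ba cb; exact: leq_trans cb ba.
by move=> a b; rewrite andbC => /anti_leq.
Qed.

Lemma intpart_filter0 (lam : intpart) : [seq i <- lam | i != 0%N] = lam.
Proof.
by apply/all_filterP/allP => i il; apply: contraNneq (intpart_pos lam) => <-.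
Qed.

Lemma sf_coef_m (lam : intpart) s :
  sf_coef (sf_m F lam) s = (perm_eq [seq i <- s | i != 0%N] lam)%:R.
Proof. by rewrite /sf_coef /= (mcoeff_mnm_sum _ _ (@monomial_predP lam)). Qed.

(** Induction on the number of monomials of [f] in [d] variables, where [d] bounds the degree:
    subtracting the multiple of [sf_m F lam] that cancels one monomial removes its whole orbit and
    introduces no new monomial. *)
Lemma sf_m_ind (P : symfun F -> Prop) :
  P 0 -> (forall c f g, P f -> P g -> P (c *: f + g)) ->
  (forall lam, P (sf_m F lam)) -> forall f, P f.
Proof.
move=> P0 PD Pm f.
have [d fd'] := sfproj_bounded f.
have fd n : (msize (f n) <= d.+1)%N by exact: leqW.
move: {fd'} (leqnn (size (msupp (f d)))) fd.
move: {2}(size _) => k; elim: k f => [|k IH] f.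
  rewrite leqn0 size_eq0 msupp_eq0 => /eqP f0 fd.
  by rewrite (sf_bounded_eq0 fd f0).
move=> fk fd; have [f0|] := eqVneq (f d) 0; first by rewrite (sf_bounded_eq0 fd f0).
rewrite -msupp_eq0; case E: (msupp (f d)) => [//|m l] _.
have mf : m \in msupp (f d) by rewrite E mem_head.
pose lam := intpart_of m; pose c := (f d)@_m.
pose g := (- c) *: sf_m F lam + f.
have gc k' : (g d)@_k' =
    if perm_eq [seq i <- k' | i != 0%N] [seq i <- m | i != 0%N] then 0
    else (f d)@_k'.
  rewrite -sf_coefE sf_coefD sf_coefZ sf_coef_m.
  have <- := permPr (perm_intpart_of m); case: ifP => [h|_].
    rewrite mulr1 -(sf_coef_filter0 f) (sf_coef_perm f h).
    rewrite (sf_coef_perm f (perm_intpart_of m)) sf_coef_filter0 sf_coefE.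
    by rewrite addNr.
  by rewrite mulr0 add0r sf_coefE.
have -> : f = c *: sf_m F lam + g.
  by rewrite /g scaleNr addrA subrr add0r.
apply: PD => //; apply: IH => [|n].
  rewrite -ltnS; apply: leq_trans fk; rewrite -[X in (X < _)%N]/(size _).
  rewrite -[(_ < _)%N]/(size (m :: msupp (g d)) <= _)%N.
  apply: uniq_leq_size.
    by rewrite /= msupp_uniq andbT -mcoeff_eq0 gc perm_refl.
  move=> k'; rewrite inE => /predU1P[-> //|]; rewrite -[_ \in msupp (g d)]negbK -[_ \in msupp (f d)]negbK -!mcoeff_eq0 gc.
  by case: ifP => //; rewrite eqxx.
(* The degree bound survives, since [lam] has the degree of [m], which occurs in [f d]. *)
rewrite /g; apply: leq_trans (msizeD_le _ _) _; rewrite geq_max fd andbT.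
apply: leq_trans (msizeZ_le _ _) _; apply: leq_trans (msize_mnm_sum _ _ _ _) _.
rewrite ltnS (perm_sumn (perm_intpart_of m)) sumn_filter0 -ltnS.
by rewrite -[sumn m]/(sumn (multinom_val m)) sumnE -/(mdeg m) (leq_trans (msize_mdeg_lt mf)).
Qed.

End MonomialSpan.

(** * Free generators of a commutative algebra *)

Section AlgebraicBases.
Context (F : fieldType).

(** Naming the evaluation used in [alg_independent] and [alg_generates] lets it carry linear and
    multiplicative structures. *)
Definition aeval (A : comAlgType F) (v : nat -> A) n (p : {mpoly F[n]}) : A :=
  mmap (in_alg A) (fun i : 'I_n => v i) p.

Definition mnm_eval (A : comAlgType F) (v : nat -> A) n (m : 'X_{1..n}) : A :=
  mmap1 (fun i : 'I_n => v i) m.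

Section Evaluation.
Context (A : comAlgType F) (v : nat -> A).

Lemma aevalE n (p : {mpoly F[n]}) :
  aeval v p = \sum_(m <- msupp p) p@_m *: mnm_eval v m.
Proof. by apply: eq_bigr => m _; rewrite /= mulr_algl. Qed.

Lemma aeval_linear n : linear (@aeval A v n).
Proof. by move=> c p q; rewrite /aeval raddfD /= mmapZ /= mulr_algl. Qed.

HB.instance Definition _ n :=
  GRing.isLinear.Build F {mpoly F[n]} A *:%R (@aeval A v n) (@aeval_linear n).

Fact aeval_monoid n : monoid_morphism (@aeval A v n).
Proof. by split=> [|p q]; rewrite /aeval ?rmorph1 ?rmorphM. Qed.

HB.instance Definition _ n :=
  GRing.isMonoidMorphism.Build {mpoly F[n]} A (@aeval A v n) (@aeval_monoid n).

Lemma aevalX n (m : 'X_{1..n}) : aeval v 'X_[m] = mnm_eval v m.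
Proof. by rewrite /aeval mmapX. Qed.

Lemma aevalXU n (i : 'I_n) : aeval v 'X_i = v i.
Proof. by rewrite aevalX /mnm_eval mmap1U. Qed.

Lemma mnm_eval_widen n (m : 'X_{1..n}) : mnm_eval v (mnmwiden m) = mnm_eval v m.
Proof.
rewrite /mnm_eval /mmap1 big_ord_recr /= mnmwiden_ordmax mulr1.
by apply: eq_bigr => i _; rewrite mnmwiden_widen.
Qed.

Lemma aeval_widen n (p : {mpoly F[n]}) : aeval v (mwiden p) = aeval v p.
Proof.
rewrite (mwidenE (leqnn _)) [in RHS](mpolywE (leqnn (msize p))) !raddf_sum /=.
by apply: eq_bigr => m _; rewrite !linearZ /= !aevalX mnm_eval_widen.
Qed.

(** Two elements may come from polynomials in different numbers of variables; widening both to the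
    larger number changes neither value. *)
Lemma aeval_wlog2 (P : A -> A -> Prop) :
  alg_generates v ->
  (forall n (p q : {mpoly F[n]}), P (aeval v p) (aeval v q)) ->
  forall a b, P a b.
Proof.
move=> gen PP a b; have [n [p ->]] := gen a; have [k [q ->]] := gen b.
suff wid n' (r : {mpoly F[n']}) N :
    (n' <= N)%N -> exists r' : {mpoly F[N]}, aeval v r' = aeval v r.
  have [p' pE] := wid _ p _ (leq_maxl n k).
  have [q' qE] := wid _ q _ (leq_maxr n k).
  by move: (PP _ p' q'); rewrite pE qE.
elim: N => [|N IH].
  by rewrite leqn0 => /eqP n0; subst n'; exists r.
rewrite leq_eqVlt => /predU1P[E|/IH[r' r'E]]; first by subst n'; exists r.
by exists (mwiden r'); rewrite aeval_widen.
Qed.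

End Evaluation.

Lemma lrmorph_aeval (A B : comAlgType F) (psi : {lrmorphism A -> B}) (v : nat -> A) n
    (p : {mpoly F[n]}) :
  psi (aeval v p) = aeval (psi \o v) p.
Proof.
rewrite !aevalE raddf_sum; apply: eq_bigr => m _ /=.
rewrite linearZ /=; congr (_ *: _); rewrite /mnm_eval /mmap1 rmorph_prod.
by apply: eq_bigr => i _; rewrite rmorphXn.
Qed.

Section Extension.
Context (A : comAlgType F) (v : nat -> A).
Hypotheses (v_ind : alg_independent v) (v_gen : alg_generates v).

(* [c] ignores trailing zeros, hence is a function of a monomial in
   infinitely many variables. *)
Lemma basis_extension (V : lmodType F) (c : seq nat -> V) :
  (forall s, c (rcons s 0%N) = c s) ->
  exists phi : A -> V, linear phi /\
    forall n (m : 'X_{1..n}), phi (mnm_eval v m) = c m.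
Proof.
move=> c0.
pose S n (p : {mpoly F[n]}) : V := \sum_(m <- msupp p) p@_m *: c m.
(* Summing over all monomials of bounded degree, rather than over the support, gives one index set
   for [p], [q] and [a *: p + q]. *)
have SE n (p : {mpoly F[n]}) k : (msize p <= k)%N ->
    S n p = \sum_(m : 'X_{1..n < k}) p@_m *: c m.
  move=> pk; pose I : subFinType _ := 'X_{1..n < k}.
  rewrite /S (big_mksub I) ?msupp_uniq //=; last first.
    by move=> x /msize_mdeg_lt /leq_trans; apply.
  by rewrite big_rmcond //= => j /memN_msupp_eq0 ->; rewrite scale0r.
have Slin n : linear (S n).
  move=> a p q; pose k := maxn (msize (a *: p + q)) (maxn (msize p) (msize q)).
  rewrite !(@SE _ _ k) ?leq_max ?leqnn ?orbT // scaler_sumr -big_split /=.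
  by apply: eq_bigr => m _; rewrite mcoeffD mcoeffZ scalerDl scalerA.
have SX n (m : 'X_{1..n}) : S n 'X_[m] = c m.
  by rewrite /S msuppX big_seq1 mcoeffX eqxx scale1r.
pose Slm n : {linear {mpoly F[n]} -> V} :=
  HB.pack (S n) (GRing.isLinear.Build F {mpoly F[n]} V *:%R (S n) (Slin n)).
have SlmE n p : S n p = Slm n p by [].
have Swid n (p : {mpoly F[n]}) : S n.+1 (mwiden p) = S n p.
  rewrite (mwidenE (leqnn _)) (SE _ p _ (leqnn _)) SlmE raddf_sum /=.
  by apply: eq_bigr => m _; rewrite SlmE linearZ /= SX c0.
have wid n (p : {mpoly F[n]}) N : (n <= N)%N ->
    exists p' : {mpoly F[N]}, aeval v p' = aeval v p /\ S N p' = S n p.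
  elim: N => [|N IH].
    by rewrite leqn0 => /eqP n0; subst n; exists p.
  rewrite leq_eqVlt => /predU1P[E|/IH[r [r1 r2]]]; first by subst n; exists p.
  by exists (mwiden r); rewrite aeval_widen Swid.
(* After widening to a common number of variables, independence makes polynomials with equal values
   equal, so [S] depends on the value alone. *)
have S_wd n k (p : {mpoly F[n]}) (q : {mpoly F[k]}) :
    aeval v p = aeval v q -> S n p = S k q.
  have [p' [p1 p2]] := wid _ p _ (leq_maxl n k).
  have [q' [q1 q2]] := wid _ q _ (leq_maxr n k).
  rewrite -p1 -q1 -p2 -q2 => /eqP; rewrite -subr_eq0 -raddfB => /eqP /v_ind.
  by move=> /eqP; rewrite subr_eq0 => /eqP ->.
have : forall a, exists x, forall n (p : {mpoly F[n]}), a = aeval v p -> x = S n p.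
  move=> a; have [n [p ->]] := v_gen a; exists (S n p) => k q; exact: S_wd.
case/choice => phi phiE; have phiS n p : phi (aeval v p) = S n p by exact: phiE.
exists phi; split=> [a x y|n m]; last by rewrite -aevalX phiS SX.
move: x y; apply: (aeval_wlog2 v_gen) => n p q.
by rewrite -linearZ -raddfD /= !phiS Slin.
Qed.

(** The universal property of free generators: the linear map sending each monomial in [v] to the
    same monomial in [w] acts on [aeval v p] as evaluation at [w], hence is multiplicative. *)
Lemma alg_extension (B : comAlgType F) (w : nat -> B) :
  exists psi : {lrmorphism A -> B}, forall i, psi (v i) = w i.
Proof.
pose c s : B := \prod_(i < size s) w i ^+ nth 0%N s i.
have c0 s : c (rcons s 0%N) = c s.
  rewrite /c size_rcons big_ord_recr /= nth_rcons ltnn eqxx mulr1.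
  by apply: eq_bigr => i _; rewrite nth_rcons ltn_ord.
have [phi [philin phiE]] := basis_extension c0.
pose L : {linear A -> B} :=
  HB.pack phi (GRing.isLinear.Build F A B *:%R phi philin).
have phiX n (m : 'X_{1..n}) : phi (mnm_eval v m) = mnm_eval w m.
  rewrite phiE /c /mnm_eval /mmap1; case: m => -[s Hs] /=.
  move/eqP: (Hs) => E; move: Hs; rewrite -E => Hs.
  by apply: eq_bigr => i _; rewrite multinomE (tnth_nth 0%N).
have phiA n (p : {mpoly F[n]}) : phi (aeval v p) = aeval w p.
  have LE x : phi x = L x by [].
  rewrite !aevalE LE raddf_sum; apply: eq_bigr => m _ /=.
  by rewrite LE linearZ /= phiX.
have phiM : monoid_morphism phi.
  split.
    by have := phiA 0%N 1; rewrite !rmorph1.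
  apply: (aeval_wlog2 v_gen) => n p q.
  by rewrite -rmorphM /= !phiA rmorphM.
pose psi : {lrmorphism A -> B} :=
  HB.pack phi (GRing.isLinear.Build F A B *:%R phi philin)
   (GRing.isMonoidMorphism.Build A B phi phiM).
exists psi => i /=.
by have := phiA i.+1 'X_ord_max; rewrite !aevalXU.
Qed.

Lemma lrmorph_eq (B : comAlgType F) (psi chi : {lrmorphism A -> B}) :
  (forall i, psi (v i) = chi (v i)) -> psi =1 chi.
Proof.
move=> E a; have [n [p ->]] := v_gen a.
rewrite -/(aeval v p) !lrmorph_aeval !aevalE; apply: eq_bigr => m _.
by congr (_ *: _); apply: eq_bigr => i _ /=; rewrite E.
Qed.

End Extension.

End AlgebraicBases.

(** * Triangular changes of generators *)

Section Triangular.
Context (F : fieldType) (A : comAlgType F) (v : nat -> A).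
Hypotheses (v_ind : alg_independent v) (v_gen : alg_generates v).

Variables (w : nat -> A) (c : nat -> F) (q : forall n, {mpoly F[n]}).
Hypothesis wE : forall n, w n = c n *: v n + aeval v (q n).
Hypothesis c0 : forall n, c n != 0.

(* The images of the [v n] under the inverse of the substitution [v |-> w]. *)
Fixpoint triangular_inverse n : seq A :=
  if n is n'.+1 then
    let z := triangular_inverse n' in
    rcons z ((c n')^-1 *: (v n' - aeval (nth 0 z) (q n')))
  else [::].

Lemma size_triangular_inverse n : size (triangular_inverse n) = n.
Proof. by elim: n => //= n IH; rewrite size_rcons IH. Qed.

Lemma nth_triangular_inverse n i :
  (i < n)%N -> nth 0 (triangular_inverse n) i = nth 0 (triangular_inverse i.+1) i.
Proof.
elim: n => // n IH; rewrite ltnS leq_eqVlt => /predU1P[-> //|ni].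
by rewrite [LHS]nth_rcons size_triangular_inverse ni IH.
Qed.

(** The endomorphism [psi] sending [v] to the solution [z] of the triangular system maps [w i] to
    [v i], so it turns a relation among the [w i] into the same relation among the [v i]. *)
Lemma triangular_alg_independent : alg_independent w.
Proof.
move=> n p p0; apply: v_ind; rewrite -/(aeval v p).
pose z i := nth 0 (triangular_inverse i.+1) i.
have zE i : z i = (c i)^-1 *: (v i - aeval z (q i)).
  rewrite {1}/z /= nth_rcons size_triangular_inverse ltnn eqxx.
  congr (_ *: (_ - _)); rewrite !aevalE; apply: eq_bigr => m _.
  congr (_ *: _); apply: eq_bigr => j _.
  by rewrite nth_triangular_inverse.
have [psi psiE] := alg_extension v_ind v_gen z.
have psiw i : psi (w i) = v i.
  rewrite wE linearD linearZ /= lrmorph_aeval psiE zE scalerA divff // scale1r.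
  rewrite [X in _ + X](_ : _ = aeval z (q i)) ?subrK //.
  rewrite !aevalE; apply: eq_bigr => m _.
  by congr (_ *: _); apply: eq_bigr => j _ /=; rewrite psiE.
have : psi (aeval w p) = 0 by rewrite [aeval w p]p0 raddf0.
rewrite lrmorph_aeval => <-; rewrite !aevalE; apply: eq_bigr => m _.
by congr (_ *: _); apply: eq_bigr => j _ /=; rewrite psiw.
Qed.

Lemma triangular_alg_generates : alg_generates w.
Proof.
(* As [q n] involves only the [v i] with [i < n], the equation for [w n] can be solved for [v n] by
   induction. *)
have vw n : exists g : nat -> {mpoly F[n]}, forall i, (i < n)%N -> v i = aeval w (g i).
  elim: n => [|n [g gE]]; first by exists (fun=> 0).
  pose h i : {mpoly F[n.+1]} := if (i < n)%N then mwiden (g i) else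
    (c n)^-1 *: ('X_ord_max - aeval (fun i => mwiden (g i)) (q n)).
  exists h => i; rewrite ltnS leq_eqVlt /h => /predU1P[->|ni]; last first.
    by rewrite ni aeval_widen gE.
  rewrite ltnn linearZ linearB /= aevalXU wE /=.
  have -> : aeval w (aeval (fun i => mwiden (g i)) (q n)) = aeval v (q n).
    rewrite lrmorph_aeval !aevalE; apply: eq_bigr => m _; congr (_ *: _).
    by apply: eq_bigr => j _ /=; rewrite aeval_widen gE.
  by rewrite addrK scalerA mulVf // scale1r.
move=> a; have [n [p ->]] := v_gen a; have [g gE] := vw n.
exists n, (aeval g p); rewrite -/(aeval w _) lrmorph_aeval -/(aeval v p).
rewrite !aevalE; apply: eq_bigr => m _; congr (_ *: _).
by apply: eq_bigr => j _ /=; rewrite gE.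
Qed.

End Triangular.

(** * The fundamental theorem in infinitely many variables, and the relations between [e] and [h] *)

Section ElementaryBasis.
Context (F : fieldType).

Definition proj n (f : symfun F) : {mpoly F[n]} := f n.

Fact proj_linear n : linear (@proj n). Proof. by []. Qed.
HB.instance Definition _ n := GRing.isLinear.Build F (symfun F) {mpoly F[n]}
  *:%R (@proj n) (@proj_linear n).

Fact proj_monoid n : monoid_morphism (@proj n). Proof. by []. Qed.
HB.instance Definition _ n := GRing.isMonoidMorphism.Build (symfun F)
  {mpoly F[n]} (@proj n) (@proj_monoid n).

(** The shift leaves out [e_0 = 1], which cannot belong to an independent family. *)
Definition elem (i : nat) : symfun F := elementary_sf F i.+1.

Lemma proj_aeval_elem n (p : {mpoly F[n]}) :
  proj n (aeval elem p) = p \mPo [tuple mesym n F i.+1 | i < n].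
Proof.
rewrite lrmorph_aeval aevalE comp_mpolyE; apply: eq_bigr => m _.
by congr (_ *: _); apply: eq_bigr => i _; rewrite tnth_mktuple.
Qed.

(** The first [n] elementary polynomials are already independent in [n] variables. *)
Lemma elem_alg_independent : alg_independent elem.
Proof.
move=> n p p0; apply: (@msym_fundamental_un0 n F).
by rewrite -proj_aeval_elem [aeval _ _]p0.
Qed.

Lemma msizeMS n (p q : {mpoly F[n]}) k l :
  (msize p <= k.+1)%N -> (msize q <= l.+1)%N -> (msize (p * q) <= (k + l).+1)%N.
Proof.
move=> pk ql; have [->|p0] := eqVneq p 0; first by rewrite mul0r mmeasure0.
have [->|q0] := eqVneq q 0; first by rewrite mulr0 mmeasure0.
rewrite msizeM // -ltnS prednK; last by rewrite addn_gt0 !lt0n !mmeasure_poly_eq0 p0.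
by rewrite -addSn -addnS leq_add.
Qed.

(** The variable of index [i] stands for [e_(i+1)], so the weight of [m] bounds the degree,
    uniformly in the number [N] of variables. *)
Lemma msize_mnm_eval_elem n (m : 'X_{1..n}) N :
  (msize (proj N (mnm_eval elem m)) <= (mnmwgt m).+1)%N.
Proof.
rewrite /mnm_eval /mmap1 rmorph_prod /mnmwgt.
apply: (big_ind2 (fun (p : {mpoly F[N]}) k => msize p <= k.+1)%N) => [||i _].
- by rewrite msize1.
- by move=> p k q l; exact: msizeMS.
rewrite rmorphXn /=; elim: (m i) => [|k IH]; first by rewrite expr0 msize1.
rewrite exprS mulSn; apply: msizeMS => //.
rewrite /proj /= mesymE.
apply: leq_trans (mmeasure_sum _ _ _ _) _; apply/bigmax_leqP => h /eqP hk.
by rewrite msizeX mdeg_mesym1 hk.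
Qed.

(** The finite theorem expresses [f d] by a polynomial [p] of controlled weight. Both [f] and
    [aeval elem p] then have degree at most [d] in any number of variables, so agreement in [d]
    variables suffices. *)
Lemma elem_alg_generates : alg_generates elem.
Proof.
move=> f; have [d fd] := sfproj_bounded f.
have [p [pE pw]] := sym_fundamental (sfproj_sym f d).
exists d, p; rewrite -/(aeval elem p); apply/eqP; rewrite -subr_eq0; apply/eqP.
apply: (@sf_bounded_eq0 _ _ d) => [n|]; last first.
  by rewrite -[LHS]/(proj d _) raddfB /= proj_aeval_elem pE subrr.
rewrite -[X in msize X]/(proj n _) raddfB; apply: leq_trans (msizeD_le _ _) _.
rewrite msizeN geq_max leqW //= aevalE raddf_sum /=.
apply: leq_trans (mmeasure_sum _ _ _ _) _; apply/bigmax_leqP_seq => m mp _.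
apply: leq_trans (msizeZ_le (proj n (mnm_eval elem m)) _) _.
apply: leq_trans (msize_mnm_eval_elem _ _) _; rewrite ltnS.
have : (mnmwgt m < mweight p)%N := mmeasure_mnm_lt _ mp.
move/leq_trans/(_ pw)/leq_trans/(_ (fd d)); exact: ltnW.
Qed.

Lemma elementary_sf0 : elementary_sf F 0 = 1.
Proof. by apply: symfunP => n; rewrite /= mesym0E mpolyC1. Qed.

Lemma complete_sf0 : complete_sf F 0 = 1.
Proof.
apply: symfunP => n; apply/mpolyP => m /=.
rewrite (mcoeff_mnm_sum _ _ (@complete_predP 0)) mcoeffC mul1r.
by rewrite /complete_pred mdeg_eq0.
Qed.

Lemma mcoeffM_sub n (p q : {mpoly F[n]}) (m : 'X_{1..n}) :
  (p * q)@_m =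
  \sum_(k : 'X_{1..n < (mdeg m).+1} | (k <= m)%MM) p@_k * q@_(m - k).
Proof. exact: mcoeff_poly_mul_lin. Qed.

Lemma sum_elementary_complete k : (0 < k)%N ->
  \sum_(i < k.+1) (-1) ^+ i *: (elementary_sf F i * complete_sf F (k - i)) = 0.
Proof.
move=> k0; apply: symfunP => n; rewrite -/(proj n _) -/(proj n _) raddf0 raddf_sum /=.
apply/mpolyP => m; rewrite raddf_sum mcoeff0 /=.
(* The coefficient of the monomial m is the sum of the (-1)^|S| over the
   subsets S of its support, that is, the product of the 1 - [0 < m i]. *)
pose X i (S : {set 'I_n}) : F :=
  (((#|S| == i) && (mesym1 S <= m)%MM) && (mdeg m == k))%:R.
transitivity (\sum_(i < k.+1) (-1) ^+ i * \sum_S X i S).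
  apply: eq_bigr => i _; rewrite mcoeffZ; congr (_ * _).
  rewrite mesymE mulr_suml raddf_sum /= big_mkcond /=.
  apply: eq_bigr => S _; rewrite /X; case: eqP => //= Si.
  have [Sm|Sm] := boolP (mesym1 S <= m)%MM => /=.
    rewrite -{1}(submK Sm) addmC mulrC mcoeffMX.
    rewrite (mcoeff_mnm_sum _ _ (@complete_predP _)) /complete_pred.
    rewrite -(eqn_add2r (mdeg (mesym1 S))) -mdegD submK // mdeg_mesym1 Si subnK //.
    by rewrite -ltnS.
  rewrite mcoeffM_sub big1 // => j jm.
  rewrite mcoeffX; case: eqP => [E|]; last by rewrite mul0r.
  by rewrite E jm in Sm.
have [mk|mk] := boolP (mdeg m == k); last first.
  by rewrite big1 // => i _; rewrite big1 ?mulr0 // => S _; rewrite /X (negPf mk) andbF.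
under eq_bigr do rewrite mulr_sumr.
rewrite exchange_big /=.
transitivity (\sum_(S : {set 'I_n}) \prod_i (if i \in S then - (0 < m i)%:R else 1 : F)).
  apply: eq_bigr => S _; rewrite /X mk.
  have [Sm|Sm] := boolP (mesym1 S <= m)%MM; last first.
    rewrite big1 => [|i _]; last by rewrite andbF mulr0.
    move: Sm => /forallPn[i]; rewrite mnmE -ltnNge => h.
    have iS : i \in S by move: h; case: (i \in S).
    by move: h; rewrite (bigD1 i) //= iS ltnS leqn0 => /eqP ->; rewrite oppr0 mul0r.
  have Sk : (#|S| < k.+1)%N.
    by rewrite ltnS -(eqP mk) -[#|S|]mdeg_mesym1 -(submK Sm) mdegD leq_addl.
  rewrite (bigD1 (Ordinal Sk)) //= eqxx mulr1 big1 ?addr0 => [|i iS]; last first.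
    by rewrite [_ == _](_ : _ = false) ?mulr0 //; apply: contraNF iS => /eqP Si; apply/eqP/val_inj.
  rewrite -big_mkcond /= -prodr_const; apply: eq_bigr => i iS.
  by move/mnm_lepP/(_ i): Sm; rewrite mnmE iS => ->.
rewrite -bigA_distr /=.
(* Since [k > 0], some exponent is positive, and its factor [1 - 1] kills the product. *)
have [i mi] : exists i, (0 < m i)%N.
  apply/existsP; apply: contraTT k0 => /existsPn mi.
  rewrite -leqNgt leqn0 -(eqP mk) mdegE big1 // => i _; apply/eqP.
  by rewrite -leqn0 leqNgt.
by rewrite (bigD1 i) //= mi addNr mul0r.
Qed.

End ElementaryBasis.

(** * Matrices with prescribed row and column sums *)

Section Margins.

(** Bounding the entries by [D] makes the set finite and covers both uses: [D = 2] for elementary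
    functions and a large [D] for complete ones. *)
Definition margins D r n (t : 'I_r -> nat) (s : 'I_n -> nat) :
    {set {ffun 'I_r -> {ffun 'I_n -> 'I_D}}} :=
  [set A : {ffun 'I_r -> {ffun 'I_n -> 'I_D}} |
    [forall j, (\sum_i A j i)%N == t j] &&
    [forall i, (\sum_j A j i)%N == s i]].

Lemma card_margins_sym D r n (t : 'I_r -> nat) (s : 'I_n -> nat) :
  #|margins D t s| = #|margins D s t|.
Proof.
pose tr r' n' (A : {ffun 'I_r' -> {ffun 'I_n' -> 'I_D}}) :
  {ffun 'I_n' -> {ffun 'I_r' -> 'I_D}} := [ffun i => [ffun j => A j i]].
have trK r' n' : cancel (@tr r' n') (@tr n' r').
  by move=> A; apply/ffunP => j; apply/ffunP => i; rewrite !ffunE.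
have bij : bijective (@tr r n) by exists (@tr n r); exact: trK.
rewrite -(on_card_preimset (onW_bij (mem (margins D s t)) bij)).
apply: eq_card => A; rewrite !inE andbC; congr (_ && _); apply: eq_forallb => i.
  by congr (_ == _); apply: eq_bigr => j _; rewrite !ffunE.
by congr (_ == _); apply: eq_bigr => j _; rewrite !ffunE.
Qed.

(** Expanding the product picks one monomial from each factor; their exponent vectors are the rows
    of a matrix whose column sums form [m]. *)
Lemma mcoeff_prod_margins (F : fieldType) D r n (p : 'I_r -> {mpoly F[n]})
    (t : 'I_r -> nat) (m : 'X_{1..n}) :
  (forall j k, (p j)@_k = ((mdeg k == t j) && [forall i, k i < D]%N)%:R) ->
  (\prod_j p j)@_m = #|margins D t m|%:R.
Proof.
move=> pE.
pose mn (a : {ffun 'I_n -> 'I_D}) : 'X_{1..n} := [multinom (a i : nat) | i < n].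
have pX j : p j = \sum_(a : {ffun 'I_n -> 'I_D} | (\sum_i a i)%N == t j) 'X_[mn a].
  apply/mpolyP => k; rewrite pE raddf_sum /=.
  have [kD|kD] := boolP [forall i, k i < D]%N; last first.
    rewrite andbF big1 // => a _; rewrite mcoeffX; case: eqP => // E.
    by move/negP: kD; case; apply/forallP => i; rewrite -E mnmE.
  pose a0 := [ffun i => Ordinal (forallP kD i)].
  have ka0 : mn a0 = k by apply/mnmP => i; rewrite mnmE ffunE.
  have da0 : (\sum_i a0 i)%N = mdeg k.
    by rewrite mdegE; apply: eq_bigr => i _; rewrite ffunE.
  rewrite andbT; have [E|E] := eqVneq (mdeg k) (t j).
    rewrite (bigD1 a0) ?da0 ?E //= ka0 mcoeffX eqxx big1 ?addr0 // => a /andP[_ aa0].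
    rewrite mcoeffX; case: eqP => // ak; case/eqP: aa0; apply/ffunP => i.
    by apply: val_inj; rewrite ffunE /= -ak mnmE.
  rewrite big1 // => a /eqP at_; rewrite mcoeffX; case: eqP => // ak.
  by case/eqP: E; rewrite -at_ -ak mdegE; apply: eq_bigr => i _; rewrite mnmE.
under eq_bigr do rewrite pX.
rewrite bigA_distr_big_dep /= raddf_sum /= -sum1_card natr_sum.
rewrite [RHS]big_mkcond [LHS]big_mkcond; apply: eq_bigr => A _.
rewrite -(big_morph (fun k => 'X_[k] : {mpoly F[n]}) (@mpolyXD n F) (@mpolyX0 n F)).
rewrite mcoeffX [in RHS]inE.
have -> : (\sum_j mn (A j) == m)%MM = [forall i, (\sum_j A j i)%N == m i].
  apply/eqP/forallP => [<- i|Am]; last apply/mnmP => i.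
    by rewrite mnm_sumE; apply/eqP/eq_bigr => j _; rewrite mnmE.
  by rewrite mnm_sumE -(eqP (Am i)); apply: eq_bigr => j _; rewrite mnmE.
have -> : (A \in family (fun j (a : {ffun 'I_n -> 'I_D}) => (\sum_i a i)%N == t j)) =
  [forall j, (\sum_i A j i)%N == t j] by [].
by case: ifP => //= _; case: [forall i, (\sum_j A j i)%N == m i].
Qed.

End Margins.

(** * The involution exchanging [e] and [h] *)

Section Omega.
Context (F : fieldType).
Implicit Types (f g : symfun F) (s t : seq nat).

Definition es s : symfun F := \prod_(k <- s) elementary_sf F k.
Definition hs s : symfun F := \prod_(k <- s) complete_sf F k.

Lemma prod_filter0 (x : nat -> symfun F) s : x 0%N = 1 ->
  \prod_(k <- [seq i <- s | i != 0%N]) x k = \prod_(k <- s) x k.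
Proof.
move=> x0; rewrite big_filter big_mkcond; apply: eq_bigr => i _.
by have [->|] := eqVneq i 0%N.
Qed.

Lemma hs_intpart s : sf_h F (intpart_of s) = hs s.
Proof.
by rewrite /sf_h (perm_big _ (perm_intpart_of s)) prod_filter0 ?complete_sf0.
Qed.

(* The parts of the partition with [nth 0 s i] parts equal to [i.+1]. *)
Definition expand s : seq nat :=
  flatten [seq nseq (nth 0%N s i) i.+1 | i <- iota 0 (size s)].

Lemma expand_rcons0 s : expand (rcons s 0%N) = expand s.
Proof.
rewrite /expand size_rcons -[in iota _ _]addn1 iotaD map_cat flatten_cat /=.
rewrite nth_rcons ltnn eqxx !cats0; congr flatten; apply/eq_in_map => i.
by rewrite mem_iota add0n nth_rcons => /andP[_ ->].
Qed.

Lemma count_expand s k :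
  count_mem k (expand s) = if k is k'.+1 then nth 0%N s k' else 0%N.
Proof.
rewrite /expand count_flatten -map_comp sumnE big_map.
under eq_bigr do rewrite /= count_nseq /=.
case: k => [|k]; first by rewrite big1_seq.
have [ks|ks] := ltnP k (size s).
  rewrite (bigD1_seq k) ?mem_iota ?iota_uniq //= eqxx mul1n big1_seq ?addn0 // => i.
  by rewrite eqSS eq_sym => /andP[/negPf -> _].
rewrite nth_default // big1_seq // => i; rewrite mem_iota add0n eqSS => /andP[_ /andP[_ i_s]].
by have [E|] := eqVneq i k => //; move: i_s; rewrite E ltnNge ks.
Qed.

Lemma mem_leq_sumn s k : k \in s -> (k <= sumn s)%N.
Proof.
elim: s => //= a s IH; rewrite inE => /predU1P[->|/IH h]; first exact: leq_addr.
exact: leq_trans h (leq_addl _ _).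
Qed.

(** The exponents are the multiplicities of the parts; [sumn s] variables suffice, as no part
    exceeds the sum. *)
Lemma expand_surj s : 0%N \notin s -> exists n (m : 'X_{1..n}), perm_eq (expand m) s.
Proof.
move=> s0; exists (sumn s), [multinom count_mem i.+1 s | i < sumn s].
apply/allP => k _ /=; rewrite count_expand; apply/eqP; case: k => [|k].
  by apply/esym/count_memPn.
have [ks|ks] := ltnP k (sumn s).
  rewrite -[RHS](mnmE (fun i : 'I_(sumn s) => count_mem i.+1 s) (Ordinal ks)).
  by rewrite multinomE (tnth_nth 0%N).
rewrite nth_default ?size_tuple ?card_ord //; apply/esym/count_memPn.
by apply: contraL ks => ks; rewrite -ltnNge (leq_trans _ (mem_leq_sumn ks)).
Qed.

Lemma mnm_eval_elem n (m : 'X_{1..n}) : mnm_eval (elem F) m = es (expand m).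
Proof.
rewrite /es /expand big_flatten big_map size_tuple /mnm_eval /mmap1.
rewrite -[n in iota 0 n]subn0 -/(index_iota 0 n) big_mkord; apply: eq_bigr => i _.
by rewrite big_nseq iter_mulr_1 mnm_tnth (tnth_nth 0%N).
Qed.

Lemma es_ind (P : symfun F -> Prop) :
  P 0 -> (forall c f g, P f -> P g -> P (c *: f + g)) ->
  (forall s, P (es s)) -> forall f, P f.
Proof.
move=> P0 PD Ps f; have [n [p ->]] := elem_alg_generates f.
rewrite -/(aeval (elem F) p) aevalE; elim: (msupp p) => [|m r IH].
  by rewrite big_nil.
by rewrite big_cons; apply: PD; rewrite // mnm_eval_elem.
Qed.

Definition omega : {lrmorphism symfun F -> symfun F} :=
  projT1 (cid (alg_extension (@elem_alg_independent F) (@elem_alg_generates F)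
    (fun i => complete_sf F i.+1))).

Lemma omega_elementary k : omega (elementary_sf F k) = complete_sf F k.
Proof.
case: k => [|k]; first by rewrite elementary_sf0 complete_sf0 rmorph1.
by rewrite /omega; case: cid => psi /= ->.
Qed.

(** Reversing the summation in [sum_elementary_complete] changes the sign by [(-1)^k]. *)
Lemma sum_complete_elementary k : (0 < k)%N ->
  \sum_(i < k.+1) (-1) ^+ i *: (complete_sf F i * elementary_sf F (k - i)) = 0.
Proof.
move=> /(sum_elementary_complete F) /(congr1 (fun f => (-1) ^+ k *: f)).
rewrite scaler0 scaler_sumr (reindex_inj rev_ord_inj) /= => E.
rewrite -[RHS]E; apply: eq_bigr => i _.
have ik : (i <= k)%N by rewrite -ltnS.
rewrite subSS subKn // scalerA [elementary_sf _ _ * _]mulrC; congr (_ *: _).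
by rewrite -{2}(subnK ik) exprD mulrAC -exprD addnn -mul2n exprM sqrrN !expr1n mul1r.
Qed.

(** Applying [omega] to the relation between [e] and [h] gives for the images of the [h_k] the
    recurrence that the [e_k] satisfy. *)
Lemma omega_complete k : omega (complete_sf F k) = elementary_sf F k.
Proof.
elim/ltn_ind: k => -[|k] IH; first by rewrite elementary_sf0 complete_sf0 rmorph1.
have := congr1 omega (@sum_elementary_complete F k.+1 isT).
rewrite raddf0 raddf_sum big_ord_recl /= expr0 scale1r rmorphM /= omega_elementary.
rewrite complete_sf0 mul1r subn0 => /eqP; rewrite addr_eq0 => /eqP ->.
have := @sum_complete_elementary k.+1 isT.
rewrite big_ord_recl /= expr0 scale1r complete_sf0 mul1r subn0 => /eqP.
rewrite addr_eq0 => /eqP ->; congr (- _); apply: eq_bigr => i _.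
by rewrite linearZ rmorphM /= omega_elementary IH // ltnS subSS leq_subr.
Qed.

Lemma omega_es s : omega (es s) = hs s.
Proof. by rewrite rmorph_prod; apply: eq_bigr => k _; exact: omega_elementary. Qed.

Lemma omega_hs s : omega (hs s) = es s.
Proof. by rewrite rmorph_prod; apply: eq_bigr => k _; exact: omega_complete. Qed.

Lemma omegaK : involutive omega.
Proof.
apply: (lrmorph_eq (@elem_alg_generates F) (psi := omega \o omega) (chi := idfun)).
by move=> i /=; rewrite omega_elementary omega_complete.
Qed.

Lemma hs_ind (P : symfun F -> Prop) :
  P 0 -> (forall c f g, P f -> P g -> P (c *: f + g)) ->
  (forall s, P (hs s)) -> forall f, P f.
Proof.
move=> P0 PD Ps f; rewrite -[f]omegaK.
elim/es_ind: (omega f) => [|c g h|s]; first by rewrite raddf0.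
  by rewrite raddfD /= linearZ; exact: PD.
by rewrite omega_es.
Qed.

(** Both coefficients count matrices, and transposition exchanges the two margins. Restricting the
    hypothesis to the entries of [s ++ t] allows a finite [D] for complete functions. *)
Lemma sf_coef_prod_sym (x : nat -> symfun F) D s t :
  (forall k n (m : 'X_{1..n}), k \in s ++ t ->
    (x k n)@_m = ((mdeg m == k) && [forall i, m i < D]%N)%:R) ->
  sf_coef (\prod_(k <- t) x k) s = sf_coef (\prod_(k <- s) x k) t.
Proof.
move=> xE.
have E s' t' : {subset t' <= s ++ t} -> sf_coef (\prod_(k <- t') x k) s' =
    #|margins D (fun j : 'I_(size t') => nth 0%N t' j)
                (fun i : 'I_(size s') => nth 0%N s' i)|%:R.
  move=> t's; rewrite /sf_coef -/(proj _ _) rmorph_prod /= (big_nth 0%N) big_mkord.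
  rewrite (@mcoeff_prod_margins _ D _ _ _ (fun j : 'I_(size t') => nth 0%N t' j)).
    congr (#|pred_of_set _|%:R); congr margins; apply: funext => i.
    by rewrite mnm_tnth (tnth_nth 0%N).
  by move=> j k; rewrite xE // t's ?mem_nth.
rewrite (E s t) => [|k kt]; last by rewrite mem_cat kt orbT.
rewrite (E t s) => [|k ks]; last by rewrite mem_cat ks.
by rewrite card_margins_sym.
Qed.

Lemma sf_coef_es_sym s t : sf_coef (es t) s = sf_coef (es s) t.
Proof.
apply: (@sf_coef_prod_sym _ 2) => k n m _.
by rewrite /= mcoeff_mesym /mechar.
Qed.

Lemma sf_coef_hs_sym s t : sf_coef (hs t) s = sf_coef (hs s) t.
Proof.
apply: (@sf_coef_prod_sym _ (sumn (s ++ t)).+1) => k n m kst.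
rewrite /= (mcoeff_mnm_sum _ _ (@complete_predP k)) /complete_pred.
case: eqP => //= mk; suff -> : [forall i, m i < (sumn (s ++ t)).+1]%N by [].
apply/forallP => i.
rewrite ltnS (leq_trans _ (mem_leq_sumn kst)) // -mk mdegE.
by rewrite (bigD1 i) //= leq_addr.
Qed.

End Omega.

(** * The Hall form and the expansion of skew elementary functions *)

Section HallForm.
Context (F : fieldType).
Implicit Types (f g u : symfun F) (s t : seq nat).

(** The functional [T g] takes [e_s] to the coefficient of [x^s] in [g]. Composed with [omega] it
    takes [h_s] there, which is the required delta when [g] is a monomial function. *)
Lemma hall_exists : exists B : symfun F -> symfun F -> F, is_hall B.
Proof.
have ext g : exists phi : symfun F -> F^o, linear phi /\
    forall n (m : 'X_{1..n}), phi (mnm_eval (elem F) m) = sf_coef g (expand m).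
  apply: (basis_extension (@elem_alg_independent F) (@elem_alg_generates F)
    (V := F^o) (c := fun s => sf_coef g (expand s))) => s.
  by rewrite expand_rcons0.
have [T TP] := choice ext.
have Tlin g c f f' : T g (c *: f + f') = c * T g f + T g f' by apply: (TP g).1.
have T0 g : T g 0 = 0.
  by have := Tlin g (-1) 0 0; rewrite scaler0 addr0 mulN1r addNr.
have Tes g s : T g (es F s) = sf_coef g s.
  have s0 : 0%N \notin [seq i <- s | i != 0%N] by rewrite mem_filter eqxx.
  have [n [m ms]] := expand_surj s0.
  rewrite /es -prod_filter0 ?elementary_sf0 // -(perm_big _ ms) -/(es _ _).
  by rewrite -mnm_eval_elem (TP g).2 (sf_coef_perm _ ms) sf_coef_filter0.
exists (fun f g => T g (omega F f)); split.
- by move=> g c f f'; rewrite raddfD /= linearZ Tlin.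
(* Linearity in [g] is checked on the spanning [e_s], where [T g] reads off a coefficient. *)
- move=> f c g g'; elim/es_ind: (omega F f) => [|d h h' IH IH'|s].
  + by rewrite !T0 mulr0 addr0.
  + by rewrite !Tlin IH IH' !mulrDr addrACA mulrCA.
  + by rewrite !Tes sf_coefD sf_coefZ.
- move=> lam mu; rewrite -[sf_h F lam]/(hs F lam) omega_hs Tes sf_coef_m.
  by rewrite intpart_filter0 intpart_perm_eq.
Qed.

Lemma hallP : is_hall (@hall F).
Proof. exact: (xgetPex _ hall_exists). Qed.

Lemma hallDl g c f f' : hall (c *: f + f') g = c * hall f g + hall f' g.
Proof. by case: hallP => H _ _; apply: H. Qed.

Lemma hallDr f c g g' : hall f (c *: g + g') = c * hall f g + hall f g'.
Proof. by case: hallP => _ H _; apply: H. Qed.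

Lemma hall0l g : hall 0 g = 0.
Proof. by have := hallDl g (-1) 0 0; rewrite scaler0 addr0 mulN1r addNr. Qed.

Lemma hall0r f : hall f 0 = 0.
Proof. by have := hallDr f (-1) 0 0; rewrite scaler0 addr0 mulN1r addNr. Qed.

Lemma hall_hs s g : hall (hs F s) g = sf_coef g s.
Proof.
rewrite -hs_intpart -(sf_coef_filter0 g) -(sf_coef_perm _ (perm_intpart_of s)).
elim/sf_m_ind: g => [|c f g IH IH'|mu].
- by rewrite hall0r /sf_coef mcoeff0.
- by rewrite hallDr IH IH' sf_coefD sf_coefZ.
case: hallP => _ _ ->.
by rewrite sf_coef_m intpart_filter0 intpart_perm_eq.
Qed.

Lemma hallC f g : hall f g = hall g f.
Proof.
elim/hs_ind: f => [|c f f' IH IH'|s]; first by rewrite hall0l hall0r.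
  by rewrite hallDl hallDr IH IH'.
elim/hs_ind: g => [|c f f' IH IH'|t]; first by rewrite hall0l hall0r.
  by rewrite hallDl hallDr IH IH'.
by rewrite !hall_hs sf_coef_hs_sym.
Qed.

Lemma hall_inj f g : (forall h, hall f h = hall g h) -> f = g.
Proof. by move=> fg; apply: sf_coefP => s; rewrite -!hall_hs hallC fg hallC. Qed.

(** For [f = h_t] both sides are coefficients of [e]-products, equal by the symmetry of zero-one
    matrix counts. *)
Lemma hall_es s f : hall (es F s) f = sf_coef (omega F f) s.
Proof.
elim/hs_ind: f => [|c f f' IH IH'|t].
- by rewrite hall0r raddf0 /sf_coef mcoeff0.
- by rewrite hallDr IH IH' raddfD /= linearZ sf_coefD sf_coefZ.
- by rewrite hallC hall_hs omega_hs sf_coef_es_sym.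
Qed.

Lemma skew_eE (lam mu : intpart) :
  let n := size lam in let m := [multinom of in_tuple lam] : 'X_{1..n} in
  skew_e F lam mu = \sum_(k : 'X_{1..n < (mdeg m).+1} | (k <= m)%MM)
    (hs F mu n)@_k *: es F (m - k)%MM.
Proof.
move=> n m; apply: xget_unique => [f|u uP].
  have -> : hall (sf_e F lam) (sf_e F mu * f) = _ := hall_es lam _.
  rewrite rmorphM /= -[sf_e F mu]/(es F mu) omega_es.
  have -> : sf_coef (hs F mu * omega F f) lam = _ := mcoeffM_sub _ _ m.
  elim/big_rec2: _ => [|k x y _ <-]; first exact: hall0l.
  by rewrite hallDl hall_es -(sf_coefE (omega F f) (m - k)%MM).
(* Uniqueness: any other solution has the same pairing with every [f]. *)
apply: hall_inj => f; rewrite uP.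
have -> : hall (sf_e F lam) (sf_e F mu * f) = _ := hall_es lam _.
rewrite rmorphM /= -[sf_e F mu]/(es F mu) omega_es.
have -> : sf_coef (hs F mu * omega F f) lam = _ := mcoeffM_sub _ _ m.
apply/esym; elim/big_rec2: _ => [|k x y _ <-]; first exact: hall0l.
by rewrite hallDl hall_es -(sf_coefE (omega F f) (m - k)%MM).
Qed.

Lemma mnm_sub_deg n (m : 'X_{1..n}) a : (a <= mdeg m)%N ->
  exists2 k : 'X_{1..n}, (k <= m)%MM & mdeg k = a.
Proof.
elim: a => [|a IH] am.
  by exists 0%MM; rewrite ?mdeg0 //; apply/mnm_lepP => i; rewrite mnm0E.
have [k km ka] := IH (ltnW am).
have [i ki] : exists i, (k i < m i)%N.
  apply/existsP; apply: contraTT am => /existsPn mk.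
  rewrite -leqNgt -ka !mdegE; apply: leq_sum => i _.
  by rewrite leqNgt.
exists (k + U_(i))%MM; last by rewrite mdegD mdeg1 ka addn1.
apply/mnm_lepP => j; rewrite mnmDE mnm1E; case: eqP => [<-|_]; first by rewrite addn1.
by rewrite addn0; apply/mnm_lepP: j.
Qed.

(** Natural coefficients exclude cancellation: the sum for [h_a h_s] is positive as soon as one term
    is, that is, when a divisor of degree [a] leaves degree [sumn s]. *)
Lemma hs_coef_nat s n (m : 'X_{1..n}) :
  exists N, (hs F s n)@_m = N%:R /\ (0 < N)%N = (mdeg m == sumn s).
Proof.
elim: s m => [|a s IH] m.
  exists (m == 0%MM); rewrite /hs big_nil mcoeff1; split=> //=.
  by rewrite mdeg_eq0; case: eqP.
have [N NP] := choice IH.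
exists (\sum_(k : 'X_{1..n < (mdeg m).+1} | (k <= m)%MM) (mdeg k == a) * N (m - k)%MM)%N.
split.
  have -> : hs F (a :: s) n = complete_sf F a n * hs F s n.
    by rewrite /hs big_cons.
  rewrite mcoeffM_sub natr_sum; apply: eq_bigr => k _.
  rewrite (mcoeff_mnm_sum _ _ (@complete_predP a)) natrM.
  by rewrite (NP _).1.
rewrite lt0n sum_nat_eq0 negb_forall; apply/existsP/eqP => [[k]|mas].
  rewrite negb_imply muln_eq0 negb_or eqb0 negbK -lt0n (NP _).2.
  by case/and3P => km /eqP <- /eqP E; rewrite /= -E -mdegD addmC submK.
have [k km ka] : exists2 k : 'X_{1..n}, (k <= m)%MM & mdeg k = a.
  by apply: mnm_sub_deg; rewrite mas leq_addr.
have kb : (mdeg k < (mdeg m).+1)%N by rewrite ltnS mas ka leq_addr.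
exists (BMultinom kb); rewrite /= km ka eqxx mul1n -lt0n (NP _).2.
by rewrite -(eqn_add2r a) -{1}ka -mdegD submK // mas addnC.
Qed.

End HallForm.

(** * Occurrence of [e_n] in a skew elementary function *)

Section Expansion.
Context (F : fieldType).
Implicit Types (s : seq nat) (r : seq (nat * seq nat)).

Definition es_comb r : symfun F := \sum_(x <- r) x.1%:R *: es F x.2.

(** Zeros are discarded because [e_0 = 1], so the test detects the terms equal to [e_n]. *)
Definition has_part_only n r := has (fun x => [seq i <- x.2 | i != 0%N] == [:: n]) r.

Lemma sumn_part_only s n : sumn s = n.+1 -> has (fun k => n < k)%N s ->
  [seq i <- s | i != 0%N] = [:: n.+1].
Proof.
elim: s => //= a s IH san; have [an _|an] := ltnP n a.
  have a1 : a = n.+1 by apply/eqP; rewrite eqn_leq an -san leq_addr.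
  rewrite -lt0n (leq_trans _ an) // a1; congr (_ :: _).
  apply/nilP; rewrite /nilp -leqn0.
  apply: leq_trans (size_le_sumn _) _; first by rewrite mem_filter eqxx.
  by rewrite sumn_filter0; move: san; rewrite a1 -[RHS]addn0 => /addnI ->.
case/hasP => k ks nk; case: a an san => [|a] an san; last first.
  move: nk; rewrite ltnNge -ltnS -san addSn ltnS.
  by rewrite (leq_trans (mem_leq_sumn ks)) // leq_addl.
by rewrite /= IH //; apply/hasP; exists k.
Qed.

Lemma largest_partP (lam : intpart) i : i \in parts lam -> (i <= largest_part lam)%N.
Proof.
rewrite /largest_part; case: lam => -[//|h l] /= hl _; rewrite inE.
case/predU1P => [-> //|il].
have := order_path_min (rev_trans leq_trans) hl.
by move/allP/(_ _ il).
Qed.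

(** A term is [e_n] when [lam - alpha] is concentrated in a single position, with value [n]; this
    needs a part of [lam] that is at least [n]. *)
Lemma skew_e_comb (lam mu : intpart) n : skew_partition n lam mu ->
  exists r, [/\ skew_e F lam mu = es_comb r,
    forall x, x \in r -> (0 < x.1)%N /\ sumn x.2 = n &
    (0 < n)%N -> has_part_only n r = (n <= largest_part lam)%N].
Proof.
move=> lm; rewrite skew_eE; set m := [multinom of in_tuple lam].
have md : mdeg m = sumn lam by rewrite /mdeg /= sumnE.
have [N NP] := choice (@hs_coef_nat F mu (size lam)).
pose l := size lam.
(* Only exponents of degree [sumn mu] are kept, since the others have coefficient zero. *)
pose r := [seq (N (bmnm k), multinom_val (m - bmnm k)%MM : seq nat) |
   k <- enum {: 'X_{1..l < (mdeg m).+1}} & (bmnm k <= m)%MM && (mdeg (bmnm k) == sumn mu)].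
have rP (k : 'X_{1..size lam}) : (k <= m)%MM -> mdeg k = sumn mu ->
    (N k, multinom_val (m - k)%MM : seq nat) \in r.
  move=> km kmu; have kb : (mdeg k < (mdeg m).+1)%N.
    by rewrite ltnS kmu md lm leq_addl.
  apply/mapP; exists (BMultinom kb) => //.
  by rewrite mem_filter /= km kmu eqxx mem_enum.
have rsum x : x \in r -> (0 < x.1)%N /\ sumn x.2 = n.
  move=> /mapP[k]; rewrite mem_filter => /andP[/andP[km kmu] _] -> /=; split.
    by rewrite (NP _).2.
  apply/eqP; rewrite -(eqn_add2r (sumn mu)) -{1}(eqP kmu) -lm -md.
  by rewrite -[X in _ == mdeg X](submK km) mdegD eqn_add2r /mdeg sumnE.
exists r; split=> //.
  rewrite /es_comb big_map big_filter big_enum_cond /= [RHS]big_mkcondr.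
  apply: eq_big => // k _; rewrite (NP _).1; case: eqP => // /eqP.
  by rewrite -(NP _).2 -eqn0Ngt => /eqP ->; rewrite scale0r.
move=> n0; apply/hasP/idP => [[x /mapP[k _ ->]] /= /eqP E|nlam].
  have : n \in [seq i <- (m - bmnm k)%MM | i != 0%N] by rewrite E mem_head.
  rewrite mem_filter => /andP[_ /tnthP[i ->]].
  rewrite -mnm_tnth mnmBE; apply: leq_trans (leq_subr _ _) _.
  by apply: largest_partP; rewrite mnm_tnth mem_tnth.
have lam0 : (0 < size lam)%N.
  move: (leq_trans n0 nlam); rewrite /largest_part; by case: (parts lam).
pose i0 := Ordinal lam0.
have mi0 : (n <= m i0)%N by rewrite mnm_tnth (tnth_nth 0%N) /= nth0.
have Um : (U_(i0) *+ n <= m)%MM.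
  apply/mnm_lepP => i; rewrite mulmnE mnm1E; case: eqP => [<-|_].
    by rewrite mul1n.
  by rewrite mul0n.
(* Removing [k] from [m] leaves exactly [n] in the position of the largest part. *)
pose k := (m - U_(i0) *+ n)%MM.
have kr : (N k, multinom_val (m - k)%MM : seq nat) \in r.
  apply: rP; first exact: lem_subr.
  apply/eqP; rewrite -(eqn_add2r n) addnC [X in _ == X]addnC -lm -md.
  by rewrite -[X in _ == mdeg X](submK Um) mdegD mdegMn mdeg1 mul1n addnC.
exists (N k, multinom_val (m - k)%MM : seq nat) => //=.
have [_ ksum] := rsum _ kr; apply/eqP.
have := @sumn_part_only (m - k)%MM n.-1; rewrite prednK //; apply=> //.
apply/hasP; exists n; rewrite ?prednK //; apply/tnthP; exists i0.
by rewrite -mnm_tnth !mnmBE mulmnE mnm1E eqxx mul1n subKn.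
Qed.

Lemma es_small s n : all (leq^~ n) s ->
  exists q : {mpoly F[n]}, es F s = aeval (elem F) q.
Proof.
elim: s => [|[|k] s IH] /=; first by exists 1; rewrite rmorph1 /es big_nil.
  move/IH => [q qE]; exists q; rewrite -qE /es big_cons.
  by rewrite elementary_sf0 mul1r.
case/andP => kn /IH[q qE]; exists ('X_(Ordinal kn) * q).
by rewrite rmorphM /= aevalXU -qE /es big_cons.
Qed.

(** A term of size [n.+1] either is [e_(n+1)] or has all parts at most [n]. The positive
    coefficients of the former add up to [N]. *)
Lemma es_comb_small r n :
  (forall x, x \in r -> (0 < x.1)%N /\ sumn x.2 = n.+1) ->
  exists N (q : {mpoly F[n]}),
    es_comb r = N%:R *: elem F n + aeval (elem F) q /\
    (0 < N)%N = has_part_only n.+1 r.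
Proof.
elim: r => [|[a s] r IH] rP.
  by exists 0%N, 0; rewrite /es_comb big_nil scale0r raddf0 addr0.
have [x xr|N [q [E Npos]]] := IH; first by apply: rP; rewrite inE xr orbT.
have /= [a0 sn] := rP (a, s) (mem_head _ _).
rewrite /es_comb big_cons -/(es_comb r) E /=.
have [sbig|ssmall] := boolP (has (fun k => n < k)%N s).
  have s1 := sumn_part_only sn sbig.
  exists (a + N)%N, q; rewrite natrD scalerDl addrA s1 eqxx addn_gt0 a0; split=> //.
  by rewrite /es -prod_filter0 ?elementary_sf0 // s1 big_seq1.
have [|q' q'E] := @es_small s n.
  by apply/allP => k ks; rewrite leqNgt; apply: contra ssmall => nk; apply/hasP; exists k.
exists N, (a%:R *: q' + q); rewrite linearP /= -q'E addrCA Npos; split=> //.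
case: eqP => // s1; case/negP: ssmall; apply/hasP; exists n.+1 => //.
have : n.+1 \in [seq i <- s | i != 0%N] by rewrite s1 mem_head.
by rewrite mem_filter => /andP[].
Qed.

Lemma coef1M (p q : {poly F}) : (p * q)`_1 = p`_0 * q`_1 + p`_1 * q`_0.
Proof. by rewrite coefM 2!big_ord_recl big_ord0 addr0. Qed.

(** Each [e_k] with [k > 0] loses its constant term, so a product of at least two of them has no
    linear term. *)
Lemma specialize_es n (psi : {lrmorphism symfun F -> {poly F}}) s :
  (forall i, psi (elem F i) = if i.+1 == n then 'X else 0) ->
  (psi (es F s))`_1 = ([seq i <- s | i != 0%N] == [:: n])%:R.
Proof.
move=> psiE; rewrite /es -prod_filter0 ?elementary_sf0 // -/(es F _).
have : 0%N \notin [seq i <- s | i != 0%N] by rewrite mem_filter eqxx.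
have psiE' i : psi (elementary_sf F i.+1) = if i.+1 == n then 'X else 0.
  exact: psiE.
have psi0 k t : (psi (es F (k.+1 :: t)))`_0 = 0.
  rewrite /es big_cons rmorphM coef0M /= psiE'.
  by case: eqP => _; rewrite ?coefX ?coef0 mul0r.
case: [seq _ <- _ | _] => [|[//|k] [|[//|l] t]] _.
- by rewrite /es big_nil rmorph1 coef1.
- rewrite /es big_seq1 psiE' eqseq_cons eqxx andbT.
  by case: eqP => _; rewrite ?coefX ?coef0.
rewrite /es big_cons -/(es F _) rmorphM coef1M /=.
rewrite psi0 psiE' mulr0 addr0; case: (_ =P [:: n]) => // _.
by case: eqP => _; rewrite ?coefX ?coef0 mul0r.
Qed.

End Expansion.

(** * Generating sequences of skew elementary functions *)

Lemma alg_generates_behead (F : fieldType) (A : comAlgType F) (u : nat -> A) :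
  alg_generates (fun n => u n.+1) -> alg_generates u.
Proof.
move=> gen a; have [n [p ->]] := gen a.
(* The variables are shifted by one to make room for [u 0]. *)
exists n.+1, (aeval (fun i => 'X_(inord i.+1)) p); rewrite -/(aeval u _).
rewrite [LHS](_ : _ = aeval (fun k => u k.+1) p) // lrmorph_aeval !aevalE; apply: eq_bigr => m _.
congr (_ *: _); apply: eq_bigr => i _ /=.
by rewrite aevalXU inordK // ltnS.
Qed.

Theorem theorem3p10 (F : fieldType) (charF0 : [pchar F] =i pred0)
    (lam mu : nat -> intpart)
    (Hseq : graded_skew_partition_sequence lam mu) :
  let u n : symfun F := skew_e F (lam n) (mu n) in
  alg_independent (fun n => u n.+1) /\ alg_generates u <->
  (forall n : nat, (1 <= n)%N -> (n <= largest_part (lam n))%N).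
Proof.
move=> u; split=> [[_ gen] n n1|lamn].
  rewrite leqNgt; apply/negP => nlam.
  have [psi psiE] := alg_extension (@elem_alg_independent F)
    (@elem_alg_generates F) (fun i => if i.+1 == n then 'X else 0 : {poly F}).
  have u1 i : (psi (u i))`_1 = 0.
    have [r [ur rsum rn]] := skew_e_comb F (Hseq i).
    rewrite /u ur /es_comb raddf_sum coef_sum big_seq big1 // => x xr /=.
    rewrite linearZ coefZ (specialize_es _ psiE) /=.
    case: eqP => [xn|]; last by rewrite mulr0.
    (* The grading leaves [u n] as the only place where [e_n] could occur. *)
    have ni : n = i by rewrite -(rsum _ xr).2 -sumn_filter0 xn /= addn0.
    subst i; have := rn n1; rewrite leqNgt nlam => /hasPn /(_ _ xr).
    by rewrite xn eqxx.
  (* Polynomials without linear term form a subalgebra of [{poly F}]. *)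
  have psi1 a : (psi a)`_1 = 0.
    have [k [p ->]] := gen a; rewrite -/(aeval u p) lrmorph_aeval aevalE coef_sum.
    rewrite big1 // => m _; rewrite coefZ /mnm_eval /mmap1.
    suff -> : (\prod_(i < k) psi (u i) ^+ m i)`_1 = 0 by rewrite mulr0.
    have M0 (x y : {poly F}) : x`_1 = 0 -> y`_1 = 0 -> (x * y)`_1 = 0.
      by move=> x1 y1; rewrite coef1M x1 y1 mulr0 mul0r addr0.
    apply: (big_ind (fun x : {poly F} => x`_1 = 0)) => // [|i _].
      by rewrite coef1.
    elim: (m i) => [|j IH]; first by rewrite expr0 coef1.
    by rewrite exprS; exact: M0.
  have := psi1 (elem F n.-1); rewrite psiE prednK // eqxx coefX => /eqP.
  by rewrite oner_eq0.
have ex n : exists cq : F * {mpoly F[n]}, cq.1 != 0 /\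
    u n.+1 = cq.1 *: elem F n + aeval (elem F) cq.2.
  have [r [ur rsum rn]] := skew_e_comb F (Hseq n.+1).
  have [N [q [E Npos]]] := es_comb_small F rsum.
  exists (N%:R, q); rewrite /u ur E; split=> //=.
  (* Characteristic zero keeps the positive integer [N] nonzero in [F]. *)
  by rewrite ((pcharf0P F).1 charF0) -lt0n Npos rn // lamn.
pose c n := (projT1 (cid (ex n))).1; pose q n := (projT1 (cid (ex n))).2.
have c0 n : c n != 0 by rewrite /c; case: cid => x [].
have uE n : u n.+1 = c n *: elem F n + aeval (elem F) (q n).
  by rewrite /c /q; case: cid => x [].
have ind := @elem_alg_independent F; have gen := @elem_alg_generates F.
split; first exact: (triangular_alg_independent ind gen (w := fun n => u n.+1) uE c0).
apply: alg_generates_behead.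
exact: (triangular_alg_generates gen (w := fun n => u n.+1) uE c0).
Qed.
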